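(* Let $G=(V,E)$ be a graph and let $(V,\mathcal{F})$ be the set system of cliques (respectively, of independent sets) of $G$. Then: 1. $(V,\mathcal{F})$ is down-closed and therefore an extremal system. 2. The VC-dimension of $(V,\mathcal{F})$ is equal to the clique-number (respectively, the independence-number) of $G$.
   Context: Graphs are finite and undirected. A clique (independent set) of $G$ is a subset of vertices every two distinct elements of which are adjacent (non-adjacent); $\emptyset$ and all singletons of vertices count both as cliques and as independent sets. The clique-number (independence-number) is the size of the largest clique (independent set). The set system of cliques (independent sets) is $(V,\mathcal{F})$ where $\mathcal{F}$ is the family of all cliques (independent sets). A set system $(X,\mathcal{F})$ is down-closed if $A\in\mathcal{F}$ and $B\subseteq A$ imply $B\in\mathcal{F}$. $Y\subseteq X$ is shattered if $\{A\cap Y:A\in\mathcal{F}\}$ is the full power set of $Y$; the VC-dimension is the largest size of a shattered set. $Y$ is strongly shattered if there is $T\subseteq X\setminus Y$ with $\{Z\cup T:Z\subseteq Y\}\subseteq\mathcal{F}$. The system is extremal if the shattered and strongly shattered sets coincide. *)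

(* Defs.v *)
From mathcomp Require Import all_boot.

Set Implicit Arguments.
Unset Strict Implicit.
Unset Printing Implicit Defensive.

(* A set system (X, F) is a family F : {set {set X}} over a finite type X. *)
Section SetSystem.
Variable X : finType.
Implicit Types (F : {set {set X}}) (Y : {set X}).

Definition down_closed F : Prop :=
  forall A B : {set X}, A \in F -> B \subset A -> B \in F.

Definition shattered F Y : bool := [set A :&: Y | A in F] == powerset Y.

Definition strongly_shattered F Y : bool :=
  [exists T : {set X},
     (T \subset ~: Y) && ([set Z :|: T | Z in powerset Y] \subset F)].

Definition extremal F : Prop :=
  forall Y, shattered F Y <-> strongly_shattered F Y.

(* No set is shattered by the empty family; its VC-dimension is then the
   junk value 0. Any nonempty family shatters set0. *)
Definition vc_dim F : nat := \max_(Y : {set X} | shattered F Y) #|Y|.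

End SetSystem.

(* A graph on the vertex set V is its adjacency relation e, assumed symmetric.
   The definitions only look at pairs of distinct vertices, so loops, if any,
   play no role. *)
Section Graph.
Variables (V : finType) (e : rel V).
Implicit Types A : {set V}.

Definition is_clique A : bool :=
  [forall x in A, forall y in A, (x != y) ==> e x y].

Definition is_independent A : bool :=
  [forall x in A, forall y in A, (x != y) ==> ~~ e x y].

Definition cliques : {set {set V}} := [set A | is_clique A].

Definition independent_sets : {set {set V}} := [set A | is_independent A].

Definition clique_number : nat := \max_(A : {set V} | is_clique A) #|A|.

Definition independence_number : nat :=
  \max_(A : {set V} | is_independent A) #|A|.

End Graph.

(* Main.v *)
Require Import Defs.
From mathcomp Require Import all_boot.

(** In a down-closed family both the shattered sets and the strongly shattered
    sets (with T empty) are exactly the members of the family. So the VC-dimension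
    is the largest size of a member. Independent sets are the cliques of the
    complement relation. *)

(** If [Y] itself is a trace [A :&: Y], it lies inside the member [A]. Conversely, each subset of a
    member [Y] is a member and is its own trace on [Y]. *)
Lemma down_closed_shattered (X : finType) (F : {set {set X}}) (Y : {set X}) :
  down_closed F -> shattered F Y = (Y \in F).
Proof.
move=> dF; apply/eqP/idP => [FY | YF].
  have: Y \in powerset Y by rewrite powersetE.
  by rewrite -FY => /imsetP[A AF ->]; apply: dF AF (subsetIl A Y).
apply/setP => B; rewrite powersetE; apply/imsetP/idP => [[A _ ->] | BY].
  exact: subsetIr.
by exists B; [apply: dF YF BY | rewrite (setIidPl BY)].
Qed.

(** Taking [Z = Y] puts [Y :|: T] in [F], and [Y] is a subset of it. With [T] empty, the sets
    required in [F] are just the subsets of [Y]. *)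
Lemma down_closed_strongly_shattered (X : finType) (F : {set {set X}})
    (Y : {set X}) :
  down_closed F -> strongly_shattered F Y = (Y \in F).
Proof.
move=> dF; apply/existsP/idP => [[T /andP[_ /subsetP sTF]] | YF].
  apply: (dF (Y :|: T)); last exact: subsetUl.
  by apply/sTF/imset_f; rewrite powersetE.
exists set0; rewrite sub0set; apply/subsetP => _ /imsetP[Z + ->].
by rewrite powersetE setU0; apply: dF.
Qed.

Lemma down_closed_extremal (X : finType) (F : {set {set X}}) :
  down_closed F -> extremal F.
Proof.
by move=> dF Y; rewrite down_closed_shattered ?down_closed_strongly_shattered.
Qed.

Lemma down_closed_vc_dim (X : finType) (F : {set {set X}}) :
  down_closed F -> vc_dim F = \max_(Y in F) #|Y|.
Proof. by move=> dF; apply: eq_bigl => Y; apply: down_closed_shattered. Qed.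

Lemma cliques_down_closed (V : finType) (e : rel V) : down_closed (cliques e).
Proof.
move=> A B; rewrite !inE => /forall_inP cA /subsetP sBA.
apply/forall_inP => x /sBA xA; apply/forall_inP => y /sBA.
exact: (forall_inP (cA x xA)).
Qed.

Lemma cliques_vc_dim (V : finType) (e : rel V) :
  vc_dim (cliques e) = clique_number e.
Proof.
rewrite (down_closed_vc_dim _ _ (@cliques_down_closed V e)).
by apply: eq_bigl => A; rewrite inE.
Qed.

Theorem mainTheorem10 (V : finType) (e : rel V) (e_sym : symmetric e) :
  ((down_closed (cliques e) /\ extremal (cliques e)) /\
   vc_dim (cliques e) = clique_number e)
  /\
  ((down_closed (independent_sets e) /\ extremal (independent_sets e)) /\
   vc_dim (independent_sets e) = independence_number e).
Proof.
have main (r : rel V) :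
    (down_closed (cliques r) /\ extremal (cliques r)) /\
    vc_dim (cliques r) = clique_number r.
  have dC := @cliques_down_closed V r.
  by split; [split; last exact: down_closed_extremal | exact: cliques_vc_dim].
(* The independent-set notions for [e] are convertible to the clique notions for its complement, so
   [main] applies without rewriting. *)
by split; [exact: main | exact: (main (fun x y => ~~ e x y))].
Qed.
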